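(* Let $\omega$ be a non-quasianalytic weight function. Then the following properties are satisfied. (1) The inclusion $\mathcal{O}_{C,\omega}(\mathbb{R}^N) \hookrightarrow \mathcal{O}_{M,\omega}(\mathbb{R}^N)$ is well-defined and continuous. (2) The inclusions $\mathcal{S}_\omega(\mathbb{R}^N)\hookrightarrow \mathcal{O}_{C,\omega}(\mathbb{R}^N)\hookrightarrow \mathcal{E}_\omega(\mathbb{R}^N)$ are well-defined and continuous.
   Context: A non-quasianalytic weight function is a continuous increasing function $\omega:[0,\infty)\to[0,\infty)$ such that: $(\alpha)$ there is $K\geq 1$ with $\omega(2t)\leq K(1+\omega(t))$ for all $t\geq 0$; $(\beta)$ $\int_1^\infty \frac{\omega(t)}{1+t^2}\,dt<\infty$; $(\gamma)$ there are $a\in\mathbb{R}$, $b>0$ with $\omega(t)\geq a+b\log(1+t)$ for all $t\geq 0$; $(\delta)$ $\varphi_\omega(t)=\omega(e^t)$ is convex. Standing normalization: $\omega$ vanishes on $[0,1]$. For $x\in\mathbb{R}^N$ put $\omega(x):=\omega(|x|)$ with $|\cdot|$ the Euclidean norm. The Young conjugate is $\varphi^*_\omega(s):=\sup_{t\geq 0}\{st-\varphi_\omega(t)\}\ge 0$, $s\geq 0$; the value $+\infty$ is allowed, with $\exp(-\infty)=0$ and $\exp(+\infty)=+\infty$. Functions are complex-valued, $\mathbb{N}=\{1,2,\dots\}$, $\mathbb{N}_0=\mathbb{N}\cup\{0\}$. $\mathcal{E}_\omega(\mathbb{R}^N)$ is the Fréchet space of all $f\in C^\infty(\mathbb{R}^N)$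 with $p_{K,m}(f):=\sup_{x\in K}\sup_{\alpha\in\mathbb{N}_0^N}|\partial^\alpha f(x)|\exp\left(-m\varphi^*_\omega(|\alpha|/m)\right)<\infty$ for all compact $K\subset\mathbb{R}^N$ and $m\in\mathbb{N}$, with the topology generated by these seminorms. $\mathcal{S}_\omega(\mathbb{R}^N)$ is the set of $f\in L^1(\mathbb{R}^N)$ with $f,\hat f\in C^\infty(\mathbb{R}^N)$ and $\|\exp(\lambda\omega)\partial^\alpha f\|_\infty<\infty$, $\|\exp(\lambda\omega)\partial^\alpha \hat f\|_\infty<\infty$ for all $\lambda>0$, $\alpha\in\mathbb{N}_0^N$. Equivalently (known), it is the set of $f\in C^\infty(\mathbb{R}^N)$ with $q_{\lambda,\mu}(f):=\sup_{\alpha}\sup_{x}\exp\left(-\lambda\varphi^*_\omega(|\alpha|/\lambda)\right)\exp(\mu\omega(x))|\partial^\alpha f(x)|<\infty$ for all $\lambda,\mu>0$. Its Fréchet topology is generated by the norms $q_{m,n}$, $m,n\in\mathbb{N}$. For $m\in\mathbb{N}$, $n\in\mathbb{Z}$, $\mathcal{O}^m_{n,\omega}(\mathbb{R}^N)$ is the space of $f\in C^\infty(\mathbb{R}^N)$ with $r_{m,n}(f):=\sup_{\alpha\in\mathbb{N}_0^N}\sup_{x\in\mathbb{R}^N}|\partial^\alpha f(x)|\exp\left(-n\omega(x)-m\varphi^*_\omega(|\alpha|/m)\right)<\infty$, normed by $r_{m,n}$. $\mathcal{O}_{M,\omega}(\mathbb{R}^N):=\bigcap_{m=1}^\infty\bigcup_{n=1}^\infty\mathcal{O}^m_{n,\omega}(\mathbb{R}^N)$,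 where each $\bigcup_{n=1}^\infty\mathcal{O}^m_{n,\omega}(\mathbb{R}^N)$ carries the locally convex inductive limit topology of the spaces $(\mathcal{O}^m_{n,\omega}(\mathbb{R}^N),r_{m,n})$, $n\in\mathbb{N}$, and $\mathcal{O}_{M,\omega}(\mathbb{R}^N)$ carries the projective limit topology over $m$. $\mathcal{O}_{C,\omega}(\mathbb{R}^N):=\bigcup_{n=1}^\infty\bigcap_{m=1}^\infty\mathcal{O}^m_{n,\omega}(\mathbb{R}^N)$, where each $\bigcap_{m=1}^\infty\mathcal{O}^m_{n,\omega}(\mathbb{R}^N)$ carries the topology generated by the norms $r_{m,n}$, $m\in\mathbb{N}$, and $\mathcal{O}_{C,\omega}(\mathbb{R}^N)$ carries the locally convex inductive limit topology over $n\in\mathbb{N}$. *)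

(* Defs.v *)
From HB Require Import structures.
From mathcomp Require Import all_boot all_order all_algebra.
From mathcomp Require Import complex.
From mathcomp Require Import all_classical all_reals all_analysis.

Set Implicit Arguments.
Unset Strict Implicit.
Unset Printing Implicit Defensive.

Import Order.TTheory GRing.Theory Num.Theory.
Import numFieldNormedType.Exports.

Local Open Scope classical_set_scope.
Local Open Scope ring_scope.

(** [Rcomplex R] is R[i] seen as a real vector space; its norm is the modulus,
    with values in R. *)
Section Rcomplex_normed.
Variable R : realType.

HB.instance Definition _ :=
  PseudoMetric.copy (Rcomplex R) (pseudoMetric_normed (Rcomplex R)).
HB.instance Definition _ := isPointed.Build (Rcomplex R) 0.
HB.instance Definition _ := NormedZmod_PseudoMetric_eq.Build R (Rcomplex R) erefl.

Lemma Rcomplex_normM (c : R[i]) (z : Rcomplex R) :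
  `|(c * z : R[i]) : Rcomplex R| = `|c : Rcomplex R| * `|z|.
Proof. exact: ComplexField.Normc.normcM. Qed.

Lemma Rcomplex_scaleE (l : R) (z : Rcomplex R) : l *: z = (l%:C%C * z : R[i]).
Proof.
by case: z => a b; rewrite /GRing.scale /GRing.mul /= !mul0r subr0 addr0.
Qed.

Lemma Rcomplex_normZ (l : R) (z : Rcomplex R) : `|l *: z| = `|l| * `|z|.
Proof.
rewrite Rcomplex_scaleE Rcomplex_normM; congr (_ * _).
by rewrite /Num.norm /= expr0n addr0 sqrtr_sqr.
Qed.

HB.instance Definition _ :=
  PseudoMetricNormedZmod_Lmodule_isNormedModule.Build R (Rcomplex R)
    Rcomplex_normZ.

Definition cmul (c : R[i]) (z : Rcomplex R) : Rcomplex R := (c * z : R[i]).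

Lemma cmulB c z z' : cmul c (z - z') = cmul c z - cmul c z'.
Proof. exact: mulrBr. Qed.

Lemma cmulZ c (l : R) z : cmul c (l *: z) = l *: cmul c z.
Proof. by rewrite /cmul !Rcomplex_scaleE mulrCA. Qed.

Lemma norm_cmul c z : `|cmul c z| = `|c : Rcomplex R| * `|z|.
Proof. exact: Rcomplex_normM. Qed.

Lemma cvg_cmul (T : Type) (F : set_system T) (FF : Filter F) (c : R[i])
    (f : T -> Rcomplex R) (l : Rcomplex R) :
  f @ F --> l -> (fun x => cmul c (f x)) @ F --> cmul c l.
Proof.
move/cvgrPdist_lt => fl; apply/cvgrPdist_lt => e e0.
have c0 : 0 < `|c : Rcomplex R| + 1 by rewrite ltr_wpDl.
have /fl : 0 < e / (`|c : Rcomplex R| + 1) by rewrite divr_gt0.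
apply: filterS => x /= h.
rewrite -cmulB norm_cmul; move: h; rewrite ltr_pdivlMr// mulrC.
by apply: le_lt_trans; rewrite ler_wpM2r// lerDl.
Qed.

End Rcomplex_normed.

(** [E] with the topology for which [B] is a subbase. *)
Definition generated_space (E : choiceType) (B : set_system E) : Type := E.

HB.instance Definition _ (E : choiceType) (B : set_system E) :=
  Choice.on (generated_space B).
HB.instance Definition _ (E : choiceType) (B : set_system E) :=
  isSubBaseTopological.Build (generated_space B) B id.

Section LocallyConvex.
Variable K : numFieldType.

Definition subspace_of (V : lmodType K) (S : submodClosed V) : Type :=
  {f : V | f \in S}.

HB.instance Definition _ (V : lmodType K) (S : submodClosed V) :=
  [isSub of subspace_of S for @sval _ _].
HB.instance Definition _ (V : lmodType K) (S : submodClosed V) :=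
  [Choice of subspace_of S by <:].
HB.instance Definition _ (V : lmodType K) (S : submodClosed V) :=
  [SubChoice_isSubLmodule of subspace_of S by <:].

Definition inclusion_map (V : lmodType K) (S T : submodClosed V) (h : {subset S <= T})
    (f : subspace_of S) : subspace_of T :=
  exist _ (val f) (h _ (valP f)).

(** The conditions are those of the library factory [PreTopologicalLmod_isTvs]. *)
Definition is_lc_topology (E : lmodType K) (tau : Topological E) : Prop :=
  let T := Topological.Pack tau in
  [/\ continuous (fun z : T * T => ((z.1 : E) + (z.2 : E) : T)),
      continuous (fun z : K^o * T => ((z.1 : K) *: (z.2 : E) : T)) &
      exists2 B : set_system T,
        (forall b, b \in B -> convex_set (b : set (convex_lmodType E))) &
        basis B].

(** The finest locally convex topology on [E] for which all the [j i] are
    continuous. A supremum of locally convex topologies is locally convex, and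
    the [j i] remain continuous for it, so that the finest one is the topology
    generated by the open sets of all of them. *)
Definition lc_final_space (E : lmodType K) (I : Type)
    (T : I -> topologicalType) (j : forall i, T i -> E) : topologicalType :=
  @generated_space E
    [set U : set E | exists tau : Topological E,
       [/\ is_lc_topology tau,
           forall i, continuous (j i : T i -> Topological.Pack tau) &
           @open (Topological.Pack tau) U]].

(** The coarsest topology on [E] for which all the [j i] are continuous. *)
Definition proj_space (E : choiceType) (I : Type)
    (T : I -> topologicalType) (j : forall i, E -> T i) : topologicalType :=
  @generated_space E [set U | exists i, exists2 O : set (T i),
                                open O & U = j i @^-1` O].

End LocallyConvex.

Definition seminorm_space (R : realType) (E : zmodType) (I : Type)
    (p : I -> E -> \bar R) : topologicalType :=
  @generated_space E
    [set U : set E | exists i (f : E) (e : R),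
       0 < e /\ U = [set g | (p i (g - f)%R < e%:E)%E]].

Record is_weight (R : realType) (w : R -> R) : Prop := IsWeight {
  weight_continuous : {within `[0, +oo[, continuous w};
  weight_nondecreasing : {in `[0, +oo[ &, {homo w : s t / s <= t}};
  weight_ge0 : forall t, 0 <= t -> 0 <= w t;
  weight_alpha : exists2 K, 1 <= K &
    forall t, 0 <= t -> w (2 * t) <= K * (1 + w t);
  weight_beta :
    (\int[lebesgue_measure]_(t in `[1%R, +oo[) (w t / (1 + t ^+ 2))%:E < +oo)%E;
  weight_gamma : exists a, exists2 b, 0 < b &
    forall t, 0 <= t -> a + b * ln (1 + t) <= w t;
  weight_delta : @convex_function R R^o [set: R^o] (fun t => w (expR t));
  weight_norm : forall t, 0 <= t <= 1 -> w t = 0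
}.

(** A weight is only relevant on [0, +oo[; its values at negative arguments are
    unconstrained and never used. *)
Record weight (R : realType) := Weight {
  weight_fun :> R -> R;
  weightP : is_weight weight_fun
}.

Section Spaces.
Variables (R : realType) (N : nat).

Local Notation RN := 'rV[R]_N.
Local Notation fct := (RN -> R[i]).
Local Notation mindex := {ffun 'I_N -> nat}.

(** The library norm on ['rV[R]_N] is the sup norm. *)
Definition enorm (x : RN) : R := Num.sqrt (\sum_i x 0 i ^+ 2).

Definition partial (i : 'I_N) (f : RN -> Rcomplex R) : RN -> Rcomplex R :=
  'D_(delta_mx 0 i) f.

Definition partials (s : seq 'I_N) (f : RN -> Rcomplex R) : RN -> Rcomplex R :=
  foldr partial f s.

Definition smooth (f : RN -> Rcomplex R) : Prop :=
  forall s : seq 'I_N, continuous (partials s f) /\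
    forall x i, derivable (partials s f) x (delta_mx 0 i).

Definition morder (a : mindex) : nat := \sum_i a i.

(** The partial derivatives are taken in a fixed order, which is immaterial for
    smooth functions. *)
Definition mderiv (a : mindex) (f : RN -> Rcomplex R) : RN -> Rcomplex R :=
  partials (flatten [seq nseq (a i) i | i <- enum 'I_N]) f.

Definition wsup (D : set RN) (W : mindex -> RN -> \bar R) (f : fct) : \bar R :=
  ereal_sup [set (`|mderiv a f x|%:E * W a x)%E | a in [set: mindex] & x in D].

Lemma is_derive_cmul (c : R[i]) (f : RN -> Rcomplex R) (x v : RN) :
  derivable f x v -> is_derive x v (cmul c \o f) (cmul c ('D_v f x)).
Proof.
move=> df.
have key : (fun h => h^-1 *: (((cmul c \o f) \o shift x) (h *: v)
    - (cmul c \o f) x)) @ 0^' --> cmul c ('D_v f x).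
  have -> : (fun h => h^-1 *: (((cmul c \o f) \o shift x) (h *: v)
      - (cmul c \o f) x)) =
    (fun h => cmul c (h^-1 *: ((f \o shift x) (h *: v) - f x))).
    by apply/funext => h; rewrite /= cmulZ cmulB.
  exact: cvg_cmul df.
split; first by apply/cvg_ex; eexists; exact: key.
exact: (cvg_lim (@norm_hausdorff _ _) key).
Qed.

Lemma partial_lin i (c : R[i]) (f g : RN -> Rcomplex R) :
  (forall x, derivable f x (delta_mx 0 i)) ->
  (forall x, derivable g x (delta_mx 0 i)) ->
  (forall x, derivable ((cmul c \o f) + g) x (delta_mx 0 i)) /\
  partial i ((cmul c \o f) + g) = (cmul c \o partial i f) + partial i g.
Proof.
move=> df dg; split.
  by move=> x; apply: derivableD => //; case: (is_derive_cmul c (df x)).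
apply/funext => x; rewrite /partial.
have [d1 d2] := is_derive_cmul c (df x).
by rewrite deriveD// d2.
Qed.

Lemma partials_lin (c : R[i]) (f g : RN -> Rcomplex R) (s : seq 'I_N) :
  smooth f -> smooth g ->
  partials s ((cmul c \o f) + g) = (cmul c \o partials s f) + partials s g.
Proof.
move=> sf sg; elim: s => //= i s ->.
by have [] := @partial_lin i c (partials s f) (partials s g)
  (fun x => (sf s).2 x i) (fun x => (sg s).2 x i).
Qed.

Lemma smooth_lin (c : R[i]) (f g : RN -> Rcomplex R) :
  smooth f -> smooth g -> smooth ((cmul c \o f) + g).
Proof.
move=> sf sg s; rewrite partials_lin//; split.
  move=> x; have h := @cvg_cmul _ _ _ (nbhs_filter x) c _ _ ((sf s).1 x).
  exact: (cvgD h ((sg s).1 x)).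
move=> x i.
by have [] := @partial_lin i c (partials s f) (partials s g)
  (fun x => (sf s).2 x i) (fun x => (sg s).2 x i).
Qed.

Lemma partials0 (s : seq 'I_N) : partials s (0 : fct) = cst 0.
Proof.
by elim: s => //= i s ->; apply/funext => x; exact: derive_cst.
Qed.

Lemma smooth0 : smooth (0 : fct).
Proof.
move=> s; rewrite partials0; split; first exact: cst_continuous.
by move=> x i; exact: derivable_cst.
Qed.

Lemma wsup_ltyP D W (f : fct) : (wsup D W f < +oo)%E <->
  exists M : R, forall a x, D x -> (`|mderiv a f x|%:E * W a x <= M%:E)%E.
Proof.
split=> [|[M h]]; last first.
  apply: (@le_lt_trans _ _ M%:E); last exact: ltry.
  by apply: ge_ereal_sup => _ [a _ [x Dx <-]]; exact: h.
have ub a x : D x -> (`|mderiv a f x|%:E * W a x <= wsup D W f)%E.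
  by move=> Dx; apply: ereal_sup_ubound; exists a => //; exists x.
case: (wsup D W f) ub => [r| |] ub // _; first by exists r.
by exists 0 => a x Dx; apply: le_trans (ub a x Dx) _; rewrite leNye.
Qed.

Lemma wsup_lin_lty D W (c : R[i]) (f g : fct) :
  (forall a x, 0 <= W a x)%E -> smooth f -> smooth g ->
  (wsup D W f < +oo)%E -> (wsup D W g < +oo)%E ->
  (wsup D W (c *: f + g)%R < +oo)%E.
Proof.
move=> W0 sf sg /wsup_ltyP[M1 h1] /wsup_ltyP[M2 h2]; apply/wsup_ltyP.
exists (`|c : Rcomplex R| * M1 + M2) => a x Dx.
have -> : mderiv a (c *: f + g)%R x =
    cmul c (mderiv a f x) + mderiv a g x :> Rcomplex R.
  by rewrite /mderiv (partials_lin c).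
apply: (@le_trans _ _ ((`|c : Rcomplex R| * `|mderiv a f x|
                        + `|mderiv a g x|)%:E * W a x)%E).
  by apply: lee_wpmul2r => //; rewrite lee_fin -norm_cmul; exact: ler_normD.
rewrite EFinD ge0_muleDl ?lee_fin ?mulr_ge0// EFinD !EFinM -muleA.
by apply: leeD; [apply: lee_wpmul2l; [rewrite lee_fin|exact: h1]|exact: h2].
Qed.

Lemma wsup0_lty D W : (wsup D W (0%R : fct) < +oo)%E.
Proof.
apply/wsup_ltyP; exists 0 => a x _; suff -> : mderiv a (0 : fct) x = 0.
  by rewrite normr0 mul0e.
by rewrite /mderiv partials0.
Qed.

Variable w : weight R.

Definition phi_conj (s : R) : \bar R :=
  ereal_sup [set (s * t - w (expR t))%:E | t in `[0, +oo[].

(** m phi*(|a| / m), only meaningful for 0 < m. *)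
Definition mphi (m : R) (a : mindex) : \bar R :=
  (m%:E * phi_conj ((morder a)%:R / m))%E.

(** Below, indices ranging over {1, 2, ...} are written [m.+1], [n.+1] with
    [m n : nat]. The bounds involve the conventions exp(-oo) = 0 and
    exp(+oo) = +oo of [expeR]. *)

Definition p_weight (m : nat) (a : mindex) (x : RN) : \bar R :=
  expeR (- mphi m%:R a).

Definition p_ (K : set RN) (m : nat) : fct -> \bar R := wsup K (p_weight m).

Definition q_weight (l mu : R) (a : mindex) (x : RN) : \bar R :=
  (expeR (- mphi l a) * (expR (mu * w (enorm x)))%:E)%E.

Definition q_ (l mu : R) : fct -> \bar R := wsup setT (q_weight l mu).

Definition r_weight (m : nat) (n : int) (a : mindex) (x : RN) : \bar R :=
  expeR (- (n%:~R * w (enorm x))%:E - mphi m%:R a).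

Definition r_ (m : nat) (n : int) : fct -> \bar R := wsup setT (r_weight m n).


Lemma p_weight_ge0 m a x : (0 <= p_weight m a x)%E.
Proof. exact: expeR_ge0. Qed.

Lemma q_weight_ge0 l mu a x : (0 <= q_weight l mu a x)%E.
Proof. by rewrite mule_ge0 ?expeR_ge0// lee_fin expR_ge0. Qed.

Lemma r_weight_ge0 m n a x : (0 <= r_weight m n a x)%E.
Proof. exact: expeR_ge0. Qed.

Lemma r_le m (n n' : int) (f : fct) : n <= n' -> (r_ m n' f <= r_ m n f)%E.
Proof.
move=> nn'; apply: ge_ereal_sup => _ [a _ [x _ <-]].
apply: le_trans (ereal_sup_ubound _); last by exists a => //; exists x.
apply: lee_wpmul2l; first by rewrite lee_fin.
rewrite lee_expeR; apply: leeB => //; rewrite leeN2 lee_fin.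
rewrite ler_wpM2r ?ler_int//.
by apply: (weight_ge0 (weightP w)); exact: sqrtr_ge0.
Qed.

Definition E_omega : {pred fct} := fun f =>
  `[< smooth f /\ forall K m, compact K -> (p_ K m.+1 f < +oo)%E >].

(** The description of S_omega by the norms [q_], which also define its
    topology; it is known to agree with the one by decay of all derivatives of
    a function and of its Fourier transform. *)
Definition S_omega : {pred fct} := fun f =>
  `[< smooth f /\ forall l mu, 0 < l -> 0 < mu -> (q_ l mu f < +oo)%E >].

Definition O_omega (m : nat) (n : int) : {pred fct} := fun f =>
  `[< smooth f /\ (r_ m n f < +oo)%E >].

Definition O_M_step (m : nat) : {pred fct} := fun f =>
  `[< exists n : nat, f \in O_omega m n.+1 >].

Definition O_M : {pred fct} := fun f =>
  `[< forall m : nat, f \in O_M_step m.+1 >].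

Definition O_C_step (n : int) : {pred fct} := fun f =>
  `[< forall m : nat, f \in O_omega m.+1 n >].

Definition O_C : {pred fct} := fun f =>
  `[< exists n : nat, f \in O_C_step n.+1 >].

Lemma O_omega_le m (n n' : int) :
  n <= n' -> {subset O_omega m n <= O_omega m n'}.
Proof.
move=> nn' f /asboolP[sf rf]; apply/asboolP; split => //.
exact: le_lt_trans (r_le m f nn') rf.
Qed.

Lemma E_omega_closed : submod_closed E_omega.
Proof.
split; first by apply/asboolP; split; [exact: smooth0|move=> *; exact: wsup0_lty].
move=> c f g /asboolP[sf pf] /asboolP[sg pg]; apply/asboolP.
split=> [|K m cK]; first exact: (@smooth_lin c).
by apply: wsup_lin_lty => //; [exact: p_weight_ge0|exact: pf|exact: pg].
Qed.

Lemma S_omega_closed : submod_closed S_omega.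
Proof.
split; first by apply/asboolP; split; [exact: smooth0|move=> *; exact: wsup0_lty].
move=> c f g /asboolP[sf pf] /asboolP[sg pg]; apply/asboolP.
split=> [|l mu l0 mu0]; first exact: (@smooth_lin c).
by apply: wsup_lin_lty => //; [exact: q_weight_ge0|exact: pf|exact: pg].
Qed.

Lemma O_omega_closed m n : submod_closed (O_omega m n).
Proof.
split; first by apply/asboolP; split; [exact: smooth0|exact: wsup0_lty].
move=> c f g /asboolP[sf pf] /asboolP[sg pg]; apply/asboolP.
split; first exact: (@smooth_lin c).
by apply: wsup_lin_lty => //; exact: r_weight_ge0.
Qed.

Lemma O_M_step_closed m : submod_closed (O_M_step m).
Proof.
split; first by apply/asboolP; exists 0%N; exact: (O_omega_closed _ _).1.
move=> c f g /asboolP[n fn] /asboolP[n' gn']; apply/asboolP.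
exists (maxn n n'); apply: (O_omega_closed _ _).2.
  by apply: O_omega_le fn; rewrite lez_nat ltnS leq_maxl.
by apply: O_omega_le gn'; rewrite lez_nat ltnS leq_maxr.
Qed.

Lemma O_M_closed : submod_closed O_M.
Proof.
split; first by apply/asboolP => m; exact: (O_M_step_closed _).1.
move=> c f g /asboolP fM /asboolP gM; apply/asboolP => m.
exact: (O_M_step_closed _).2.
Qed.

Lemma O_C_step_closed n : submod_closed (O_C_step n).
Proof.
split; first by apply/asboolP => m; exact: (O_omega_closed _ _).1.
move=> c f g /asboolP fM /asboolP gM; apply/asboolP => m.
exact: (O_omega_closed _ _).2.
Qed.

Lemma O_C_closed : submod_closed O_C.
Proof.
split; first by apply/asboolP; exists 0%N; exact: (O_C_step_closed _).1.
move=> c f g /asboolP[n /asboolP fn] /asboolP[n' /asboolP gn']; apply/asboolP.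
exists (maxn n n'); apply: (O_C_step_closed _).2; apply/asboolP => m.
  by apply: O_omega_le (fn m); rewrite lez_nat ltnS leq_maxl.
by apply: O_omega_le (gn' m); rewrite lez_nat ltnS leq_maxr.
Qed.

HB.instance Definition _ := GRing.isSubmodClosed.Build _ _ E_omega E_omega_closed.
HB.instance Definition _ := GRing.isSubmodClosed.Build _ _ S_omega S_omega_closed.
HB.instance Definition _ m n :=
  GRing.isSubmodClosed.Build _ _ (O_omega m n) (O_omega_closed m n).
HB.instance Definition _ m :=
  GRing.isSubmodClosed.Build _ _ (O_M_step m) (O_M_step_closed m).
HB.instance Definition _ := GRing.isSubmodClosed.Build _ _ O_M O_M_closed.
HB.instance Definition _ n :=
  GRing.isSubmodClosed.Build _ _ (O_C_step n) (O_C_step_closed n).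
HB.instance Definition _ := GRing.isSubmodClosed.Build _ _ O_C O_C_closed.

Lemma O_omega_sub_step m n : {subset O_omega m (n.+1 : nat) <= O_M_step m}.
Proof. by move=> f fO; apply/asboolP; exists n. Qed.

Lemma O_M_sub_step m : {subset O_M <= O_M_step m.+1}.
Proof. by move=> f /asboolP. Qed.

Lemma O_C_step_sub n : {subset O_C_step (n.+1 : nat) <= O_C}.
Proof. by move=> f fO; apply/asboolP; exists n. Qed.

Definition E_omega_space : topologicalType :=
  @seminorm_space R (subspace_of E_omega) ({K : set RN | compact K} * nat)
    (fun Km f => p_ (sval Km.1) Km.2.+1 (val f)).

Definition S_omega_space : topologicalType :=
  @seminorm_space R (subspace_of S_omega) (nat * nat)
    (fun mn f => q_ mn.1.+1%:R mn.2.+1%:R (val f)).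

Definition O_omega_space (m : nat) (n : int) : topologicalType :=
  @seminorm_space R (subspace_of (O_omega m n)) unit
    (fun _ f => r_ m n (val f)).

Definition O_M_step_space (m : nat) : topologicalType :=
  @lc_final_space R[i] (subspace_of (O_M_step m)) nat
    (fun n => O_omega_space m n.+1) (fun n => inclusion_map (@O_omega_sub_step m n)).

Definition O_M_space : topologicalType :=
  @proj_space (subspace_of O_M) nat
    (fun m => O_M_step_space m.+1) (fun m => inclusion_map (@O_M_sub_step m)).

Definition O_C_step_space (n : int) : topologicalType :=
  @seminorm_space R (subspace_of (O_C_step n)) nat
    (fun m f => r_ m.+1 n (val f)).

Definition O_C_space : topologicalType :=
  @lc_final_space R[i] (subspace_of O_C) nat
    (fun n => O_C_step_space n.+1) (fun n => inclusion_map (@O_C_step_sub n)).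

End Spaces.

Arguments E_omega {R} N w _.
Arguments S_omega {R} N w _.
Arguments O_omega {R} N w m n _.
Arguments O_M_step {R} N w m _.
Arguments O_M {R} N w _.
Arguments O_C_step {R} N w n _.
Arguments O_C {R} N w _.

(* Main.v *)
(** The weights compare pointwise: on a compact set [exp(n w)] is bounded, so
    that [p_{K,m} <= C r_{m,n}], and [r_{m,n} <= q_{m,1}] because [w >= 0].
    Hence the maps between the steps are continuous. To pass to the inductive
    limits, one uses that a linear map pulls a locally convex topology back to
    a locally convex one, so that a linear map out of the limit into a locally
    convex space is continuous as soon as it is continuous on every step; for
    [E_omega] this requires that a topology given by seminorms is locally
    convex. *)

Require Import Defs.
From HB Require Import structures.
From mathcomp Require Import all_boot all_order all_algebra.
From mathcomp Require Import complex.
From mathcomp Require Import all_classical all_reals all_analysis.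

Set Implicit Arguments.
Unset Strict Implicit.
Unset Printing Implicit Defensive.

Import Order.TTheory GRing.Theory Num.Theory.
Import numFieldNormedType.Exports.
Local Open Scope classical_set_scope.
Local Open Scope ring_scope.

(** * Topologies generated by a subbase *)

Lemma generated_open (E : choiceType) (B : set_system E) (U : set E) :
  B U -> open (U : set (generated_space B)).
Proof.
move=> BU; exists [set U]; last by rewrite bigcup_set1.
by move=> _ ->; apply: finI_from1.
Qed.

(** Open sets are unions of finite intersections of members of [B], and preimages commute with both
    operations. *)
Lemma generated_continuous (E : choiceType) (B : set_system E)
    (X : topologicalType) (f : X -> generated_space B) :
  (forall U, B U -> open (f @^-1` U)) -> continuous f.
Proof.
move=> fB; apply/continuousP => _ [D' D'B <-].
rewrite preimage_bigcup; apply: bigcup_open => A /D'B[F FB <-].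
rewrite preimage_bigcap bigcap_fset big_seq.
by elim/big_ind: _ => [|U V|U /FB /set_mem];
  [exact: openT|exact: openI|exact: fB].
Qed.

(** * Final locally convex topologies and projective limits *)

Section Final.
Variable K : numFieldType.

(** Linearity lets [g] commute with the vector space operations, so their continuity can be checked
    in [F]; preimages of convex sets under [g] are convex. *)
Lemma initial_lc (E F : lmodType K) (tau : Topological F)
    (g : {linear E -> F}) :
  is_lc_topology tau ->
  is_lc_topology (Topological.class
    (initial_topology (g : E -> Topological.Pack tau))).
Proof.
case=> addc scalec [B Bconv [Bopen Bcvg]].
set T := Topological.Pack tau.
set W := initial_topology (g : E -> T).
have gc : continuous (g : W -> T) := @initial_continuous E T g.
(* Universal property of the initial topology: continuity into [W] is tested after composing with
   [g]. *)
have initcont (X : topologicalType) (h : X -> W) :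
    continuous ((g : W -> T) \o h) -> continuous h.
  move=> /continuousP hc; apply/continuousP => _ [A Ao <-].
  by rewrite -comp_preimage; exact: hc.
split.
- apply: (initcont (W * W)%type) => z.
  rewrite (_ : _ \o _ = (fun z : T * T => ((z.1 : F) + (z.2 : F) : T)) \o
    (fun z : W * W => ((g : W -> T) z.1, (g : W -> T) z.2))); last first.
    by apply/funext => y /=; rewrite raddfD.
  apply: continuous_comp; last exact: addc.
  apply: cvg_pair; (apply: (@cvg_comp _ _ _ _ (g : W -> T)); last exact: gc).
  + exact: cvg_fst.
  + exact: cvg_snd.
- apply: (initcont (K^o * W)%type) => z.
  rewrite (_ : _ \o _ = (fun z : K^o * T => ((z.1 : K) *: (z.2 : F) : T)) \o
    (fun z : K^o * W => (z.1, (g : W -> T) z.2))); last first.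
    by apply/funext => y /=; rewrite linearZ.
  apply: continuous_comp; last exact: scalec.
  apply: (@cvg_pair _ _ _ (nbhs z) (nbhs (z.1 : K^o)) (nbhs (g z.2 : T))
    _ _ _ fst (fun z => g z.2)); first exact: cvg_fst.
  by apply: (@cvg_comp _ _ _ _ (g : W -> T)); [exact: cvg_snd|exact: gc].
- exists [set g @^-1` b | b in B].
    move=> b /set_mem[b' /mem_set b'B <-] x y l /set_mem xb /set_mem yb.
    have := Bconv _ b'B (g x) (g y) l (mem_set xb) (mem_set yb).
    move=> /set_mem h; apply/mem_set => /=; move: h.
    by rewrite /conv/= /conv/= linearD !linearZ.
  split=> [_ [b /Bopen bo <-]|x A]; first by exists b.
  move=> [_ [[V Oo <-] Vx VA]].
  have /Bcvg[b [bB bx] bV] : nbhs (g x : T) V by exact: open_nbhs_nbhs.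
  exists (g @^-1` b); first by split=> //; exists b.
  by apply: subset_trans VA => y; exact: bV.
Qed.

Section lc_final.
Variables (E : lmodType K) (I : Type) (T : I -> topologicalType).
Variable j : forall i, T i -> E.

Lemma lc_final_inj_continuous i : continuous (@j i : T i -> lc_final_space j).
Proof.
apply: generated_continuous => U [tau [_ jc Uo]].
by have /continuousP := @jc i; exact.
Qed.

(** The pullback of [tau] along [g] is locally convex and makes every [j i] continuous. It is
    therefore one of the topologies that generate the final one. *)
Lemma lc_final_continuous (F : lmodType K) (tau : Topological F)
    (g : {linear E -> F}) :
  is_lc_topology tau ->
  (forall i, continuous ((g : E -> Topological.Pack tau) \o @j i)) ->
  continuous (g : lc_final_space j -> Topological.Pack tau).
Proof.
move=> lctau gj; apply/continuousP => U Uo; apply: generated_open.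
exists (Topological.class (initial_topology (g : E -> Topological.Pack tau))).
split; [exact: initial_lc| |by exists U].
move=> i; apply/continuousP => _ [A Ao <-].
by rewrite -comp_preimage; have /continuousP := @gj i; exact.
Qed.

End lc_final.

(** Continuity is tested against each locally convex topology on [F] that generates the target. This
    avoids proving that the target, a supremum of such topologies, is itself locally convex. *)
Lemma lc_final_map_continuous (E F : lmodType K) (I J : Type)
    (T : I -> topologicalType) (j : forall i, T i -> E)
    (T' : J -> topologicalType) (j' : forall i, T' i -> F)
    (g : {linear E -> F}) :
  (forall i, continuous ((g : E -> lc_final_space j') \o @j i)) ->
  continuous (g : lc_final_space j -> lc_final_space j').
Proof.
move=> gj; apply: generated_continuous => U [tau [lctau j'c Uo]].
have gc : continuous (g : lc_final_space j -> Topological.Pack tau).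
  apply: lc_final_continuous => // i; apply/continuousP => V Vo.
  have /continuousP := @gj i; apply; apply: generated_open.
  by exists tau.
by have /continuousP := gc; exact.
Qed.

Lemma proj_space_continuous (E : choiceType) (I : Type)
    (T : I -> topologicalType) (j : forall i, E -> T i)
    (X : topologicalType) (f : X -> proj_space j) :
  (forall i, continuous (@j i \o f)) -> continuous f.
Proof.
move=> jf; apply: generated_continuous => _ [i [U Uo ->]].
by rewrite -comp_preimage; have /continuousP := @jf i; exact.
Qed.

Lemma inclusion_map_linear (V : lmodType K) (S T : submodClosed V)
  (h : {subset S <= T}) : linear (inclusion_map h).
Proof. by move=> a u v; apply: val_inj. Qed.

HB.instance Definition _ (V : lmodType K) (S T : submodClosed V)
  (h : {subset S <= T}) :=
  GRing.isLinear.Build K (subspace_of S) (subspace_of T) _ (inclusion_map h)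
    (inclusion_map_linear h).

End Final.

(** [p] is only compared with positive reals: [p_ K m] takes the value [-oo]
    when [K] is empty, in which case [q] is [0]. *)
Definition is_seminorm (R : realType) (E : lmodType R[i]) (p : E -> \bar R) :=
  exists q : E -> R,
    [/\ forall f, 0 <= q f,
        forall f g, q (f + g) <= q f + q g,
        forall c f, q (c *: f) <= `|c : Rcomplex R| * q f &
        forall f e, 0 < e -> (p f < e%:E)%E = (q f < e)].

(** * Seminorm topologies are locally convex; continuity of linear maps between them *)

Section seminorm.
Context {R : realType}.

Lemma norm_complexE (c : R[i]) : `|c| = `|c : Rcomplex R|%:C%C.
Proof. by []. Qed.

Lemma convex_setI (K : numFieldType) (E : lmodType K)
    (A B : set (convex_lmodType E)) :
  convex_set A -> convex_set B -> convex_set (A `&` B).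
Proof.
move=> cA cB x y l; rewrite !in_setI => /andP[xA xB] /andP[yA yB].
by rewrite cA// cB.
Qed.

Section lc.
Variables (E : lmodType R[i]) (I : Type) (p : I -> E -> \bar R).
Hypothesis semip : forall i, is_seminorm (p i).

Lemma seminorm_ball_nbhs i (f : E) (e : R) : 0 < e ->
  nbhs (f : seminorm_space p) [set g : E | p i (g - f) < e%:E]%E.
Proof.
move=> e0; apply: open_nbhs_nbhs; split.
  by apply: generated_open; exists i, f, e.
have [q [_ _ qZ pq]] := semip i.
(* [q 0 = 0] follows from the scaling bound at the scalar 0. *)
rewrite /= pq// subrr -(scale0r (0 : E)).
by apply: le_lt_trans (qZ _ _) _; rewrite normr0 mul0r.
Qed.

Lemma seminorm_ball_convex i (f : E) (e : R) : 0 < e ->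
  convex_set ([set g : E | p i (g - f) < e%:E]%E : set (convex_lmodType E)).
Proof.
move=> e0 x y l; have [q [q0 qD qZ pq]] := semip i.
move=> /set_mem/=; rewrite pq// => qx /set_mem/=; rewrite pq// => qy.
apply/mem_set => /=; rewrite pq// /conv/= /conv/=.
set s : R[i] := l%:num; rewrite /unstable.onem.
have s0 : 0 <= s by apply: (ge0 l).
have s1 : s <= 1 by apply: (le1 l).
have -> : s *: x + (1 - s) *: y - f =
    s *: ((x : E) - f) + (1 - s) *: ((y : E) - f).
  by rewrite !scalerBr addrACA -opprD -scalerDl (addrC s) subrK scale1r.
(* The convex coefficient [s] lives in [R[i]], but being nonnegative it equals its modulus [t], a
   real number in [0, 1]. *)
pose t := `|s : Rcomplex R|.
have sE : s = t%:C%C by rewrite -norm_complexE ger0_norm.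
have t1 : t <= 1 by rewrite -lecR -sE.
have tE : `|(1 - s : R[i]) : Rcomplex R| = 1 - t.
  apply: complexI; rewrite -norm_complexE ger0_norm ?subr_ge0//.
  by rewrite rmorphB/= -sE.
apply: le_lt_trans (qD _ _) _; apply: le_lt_trans (lerD (qZ _ _) (qZ _ _)) _.
rewrite tE -/t.
(* The strict inequality is drawn from the term in [x], which requires [t] to be positive; for
   [t = 0] only the term in [y] remains. *)
have [->|t0] := eqVneq t 0; first by rewrite mul0r add0r subr0 mul1r.
rewrite (_ : e = t * e + (1 - t) * e); last first.
  by rewrite -mulrDl addrC subrK mul1r.
apply: ltr_leD; last by rewrite ler_wpM2l ?subr_ge0// ltW.
by rewrite ltr_pM2l// lt_neqAle eq_sym t0 normr_ge0.
Qed.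

Lemma seminorm_space_lc : is_lc_topology (Topological.class (seminorm_space p)).
Proof.
split.
- apply: generated_continuous => _ [i [h [e [e0 ->]]]].
  have [q [q0 qD qZ pq]] := semip i.
  rewrite openE => -[f g] /=; rewrite /interior/= pq// => he.
  pose d := (e - q (f + g - h)) / 2.
  have d0 : 0 < d by rewrite divr_gt0// subr_gt0.
  exists ([set f' : E | p i (f' - f) < d%:E]%E,
          [set g' : E | p i (g' - g) < d%:E]%E).
    by split; exact: seminorm_ball_nbhs.
  move=> [f' g'] /= []; rewrite !pq// => hf hg.
  have -> : f' + g' - h = (f' - f) + (g' - g) + (f + g - h).
    by rewrite [X in _ = X + _]addrACA -opprD addrA subrK.
  apply: le_lt_trans (qD _ _) _; apply: le_lt_trans (lerD (qD _ _) (lexx _)) _.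
  by rewrite -ltrBrDr (splitr (e - _)) ltrD.
- apply: generated_continuous => _ [i [h [e [e0 ->]]]].
  have [q [q0 qD qZ pq]] := semip i.
  rewrite openE => -[c f] /=; rewrite /interior/= pq// => he.
  pose d := e - q (c *: f - h).
  have d0 : 0 < d by rewrite subr_gt0.
  (* [r] and [u] each give half of the slack [d] in the splitting c'f' - h = c'(f' - f) + (c' - c)f
     + (cf - h), where |c'| is at most |c| + [r]. The 1 added in [r] excludes a zero denominator;
     the one in [u] makes the first estimate strict. *)
  pose r := d / 2 / (q f + 1).
  pose u := d / 2 / (`|c : Rcomplex R| + r + 1).
  have r0 : 0 < r by rewrite !divr_gt0// ltr_wpDl.
  have u0 : 0 < u by rewrite !divr_gt0// ltr_wpDl// addr_ge0// ltW.
  exists (ball c r%:C%C, [set f' : E | p i (f' - f) < u%:E]%E).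
    by split; [apply: nbhsx_ballx; rewrite ltcR|exact: seminorm_ball_nbhs].
  move=> [c' f'] /= [cc']; rewrite !pq// => ff'.
  have {}cc' : `|(c' - c : R[i]) : Rcomplex R| < r.
    by move: cc'; rewrite /ball/= distrC norm_complexE ltcR.
  have -> : c' *: f' - h = c' *: (f' - f) + (c' - c) *: f + (c *: f - h).
    by rewrite scalerBr scalerBl !subrKA.
  apply: le_lt_trans (qD _ _) _; apply: le_lt_trans (lerD (qD _ _) (lexx _)) _.
  rewrite -ltrBrDr (splitr (e - _)).
  apply: le_lt_trans (lerD (qZ _ _) (qZ _ _)) _; apply: ltr_leD.
    have u1 : 0 < `|c : Rcomplex R| + r + 1.
      by rewrite ltr_wpDl// addr_ge0// ltW.
    rewrite (_ : _ / 2 = (`|c : Rcomplex R| + r + 1) * u); last first.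
      by rewrite /u [RHS]mulrC divfK// gt_eqF.
    apply: (@le_lt_trans _ _ ((`|c : Rcomplex R| + r) * u)).
      apply: ler_pM => //; last exact: ltW.
      apply: (@le_trans _ _
        (`|c : Rcomplex R| + `|(c' - c : R[i]) : Rcomplex R|)).
        by rewrite -{1}(subrKC c c'); exact: ler_normD.
      by rewrite lerD2l ltW.
    by rewrite ltr_pM2r// ltrDl.
  rewrite (_ : _ / 2 = r * (q f + 1)); last first.
    by rewrite /r divfK// gt_eqF// ltr_wpDl.
  by apply: ler_pM => //; [exact: ltW|rewrite lerDl].
(* The finite intersections of seminorm balls form the convex basis. *)
- exists [set U | finI_from [set U : set E | exists i (f : E) (e : R),
       0 < e /\ U = [set g | (p i (g - f)%R < e%:E)%E]] id U].
  + move=> _ /set_mem[F FB <-]; rewrite bigcap_fset big_seq.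
    elim/big_ind: _ => [||U /FB /set_mem [i [f [e [e0 ->]]]]].
    * by move=> *; exact: in_setT.
    * exact: convex_setI.
    * exact: seminorm_ball_convex.
  + split.
      by move=> U UB; exists [set U]; [move=> _ ->|rewrite bigcup_set1].
    move=> x A [_ [[D DB <-] [U DU Ux] UA]]; exists U.
      by split=> //; exact: DB.
    by apply: subset_trans UA; exact: bigcup_sup.
Qed.

End lc.

(** By linearity, the estimate at the origin applies to differences and so gives continuity at every
    point. *)
Lemma seminorm_continuous (E F : lmodType R[i]) (I J : Type)
    (p : I -> E -> \bar R) (p' : J -> F -> \bar R) (h : {linear E -> F}) :
  (forall i, is_seminorm (p i)) -> (forall i, is_seminorm (p' i)) ->
  (forall k e, 0 < e -> exists i, exists2 d, 0 < d &
    forall f, (p i f < d%:E -> p' k (h f) < e%:E)%E) ->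
  continuous (h : seminorm_space p -> seminorm_space p').
Proof.
move=> sp sp' hpp; apply: generated_continuous => _ [k [g [e [e0 ->]]]].
have [q [q0 qD qZ pq]] := sp' k.
rewrite openE => f /=; rewrite /interior pq// => he.
have d0 : 0 < e - q (h f - g) by rewrite subr_gt0.
have [i [d dgt0 hd]] := hpp k _ d0.
apply: filterS (seminorm_ball_nbhs sp i f dgt0) => f' /= /hd.
rewrite !pq// => hf; rewrite -(subrK (h f) (h f')) -addrA -raddfB.
by apply: le_lt_trans (qD _ _) _; rewrite -ltrBrDr.
Qed.

End seminorm.

(** * Weighted suprema of derivatives as seminorms *)

Section wsup.
Context {R : realType} {N : nat}.
Local Notation RN := 'rV[R]_N.
Local Notation fct := (RN -> R[i]).

Implicit Types (D : set RN) (W : {ffun 'I_N -> nat} -> RN -> \bar R).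

Lemma wsup_leP D W (f : fct) (M : \bar R) : (wsup D W f <= M)%E <->
  forall a x, D x -> (`|mderiv a f x|%:E * W a x <= M)%E.
Proof.
split=> [fM a x Dx|fM]; last first.
  by apply: ge_ereal_sup => _ [a _ [x Dx <-]]; exact: fM.
by apply: le_trans fM; apply: ereal_sup_ubound; exists a => //; exists x.
Qed.

Lemma wsup_lin_le D W (c : R[i]) (f g : fct) (A B : R) :
  (forall a x, 0 <= W a x)%E -> smooth f -> smooth g ->
  (wsup D W f <= A%:E -> wsup D W g <= B%:E ->
   wsup D W (c *: f + g)%R <= (`|c : Rcomplex R| * A + B)%:E)%E.
Proof.
move=> W0 sf sg /wsup_leP fA /wsup_leP gB; apply/wsup_leP => a x Dx.
have -> : mderiv a (c *: f + g)%R x =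
    cmul c (mderiv a f x) + mderiv a g x :> Rcomplex R.
  by rewrite /mderiv (partials_lin c).
apply: (@le_trans _ _ ((`|c : Rcomplex R| * `|mderiv a f x|
                        + `|mderiv a g x|)%:E * W a x)%E).
  by apply: lee_wpmul2r => //; rewrite lee_fin -norm_cmul; exact: ler_normD.
rewrite EFinD ge0_muleDl ?lee_fin ?mulr_ge0// EFinD !EFinM -muleA.
by apply: leeD; [apply: lee_wpmul2l; [rewrite lee_fin|exact: fA]|exact: gB].
Qed.

Lemma wsup_lt_dominated D W W' (C e : R) (f : fct) : 0 < C ->
  (forall a x, D x -> W a x <= C%:E * W' a x)%E ->
  (wsup setT W' f < (e / C)%:E -> wsup D W f < e%:E)%E.
Proof.
move=> C0 WW' fe.
(* Pointwise bounds give only a non-strict bound on a supremum, so a real [r] strictly below [e / C]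
   is inserted. *)
have [r fr re] : exists2 r : R, (wsup setT W' f <= r%:E)%E & r < e / C.
  case: (wsup setT W' f) fe => [r| |] //; first by exists r.
  by exists (e / C - 1); rewrite ?leNye// ltrBlDr ltrDl.
apply: (@le_lt_trans _ _ (C * r)%:E); last first.
  by rewrite lte_fin mulrC -ltr_pdivlMr.
apply/wsup_leP => a x Dx; move/wsup_leP: fr => /(_ a x I) fr.
apply: (@le_trans _ _ (`|mderiv a f x|%:E * (C%:E * W' a x))%E).
  by apply: lee_wpmul2l; [rewrite lee_fin|exact: WW'].
by rewrite muleCA EFinM lee_wpmul2l// lee_fin ltW.
Qed.

Definition seminorm_on (S : submodClosed fct) (p : fct -> \bar R) : Prop :=
  is_seminorm (fun f : subspace_of S => p (val f)).

(** Smoothness makes the derivatives linear, and finiteness gives a real-valued [q]. The single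
    estimate [qlin] contains subadditivity ([c = 1]) and the scaling bound ([g = 0]). *)
Lemma wsup_seminorm (S : submodClosed fct) D W :
  (forall a x, 0 <= W a x)%E ->
  (forall f, f \in S -> smooth f /\ (wsup D W f < +oo)%E) ->
  seminorm_on S (wsup D W).
Proof.
move=> W0 SP.
(* The maximum with 0 replaces the value -oo of a supremum over an empty [D], without affecting
   comparisons with positive reals. *)
pose q (f : subspace_of S) : R := fine (maxe 0%E (wsup D W (val f))).
have qE f : (q f)%:E = maxe 0%E (wsup D W (val f)).
  rewrite fineK// ge0_fin_numE ?le_max ?lexx//.
  by rewrite gt_max ltry; exact: (SP _ (valP f)).2.
have q0 f : 0 <= q f by rewrite -lee_fin qE le_max lexx.
have qlin c f g : q (c *: f + g) <= `|c : Rcomplex R| * q f + q g.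
  rewrite -lee_fin qE ge_max lee_fin addr_ge0 ?mulr_ge0//=.
  apply: wsup_lin_le => //.
  - exact: (SP _ (valP f)).1.
  - exact: (SP _ (valP g)).1.
  - by rewrite qE le_max lexx orbT.
  - by rewrite qE le_max lexx orbT.
exists q; split=> // [f g|c f|f e e0].
- have := qlin 1 f g; rewrite scale1r.
  suff -> : `|(1 : R[i]) : Rcomplex R| = 1 by rewrite mul1r.
  by apply: complexI; rewrite -norm_complexE normr1.
- have := qlin c f 0; rewrite addr0.
  suff -> : q 0 = 0 by rewrite addr0.
  apply/eqP; rewrite eq_le q0 andbT -lee_fin qE ge_max lexx/=.
  apply/wsup_leP => a x _; suff -> : mderiv a (0 : fct) x = 0.
    by rewrite normr0 mul0e.
  by rewrite /mderiv partials0.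
- by rewrite -[RHS]lte_fin qE gt_max lte_fin e0.
Qed.

End wsup.

(** * Pointwise comparison of the weights *)

Section inclusions.
Context {R : realType} {N : nat} (w : weight R).
Local Notation RN := 'rV[R]_N.

(** Links the sup norm, in which compact sets are bounded, to the Euclidean norm inside the
    weight. *)
Lemma enorm_le (x : RN) : enorm x <= Num.sqrt N%:R * `|x|.
Proof.
rewrite -[X in _ * X]ger0_norm// -sqrtr_sqr -sqrtrM// ler_wsqrtr//.
apply: (@le_trans _ _ (\sum_(i < N) `|x| ^+ 2)).
  apply: ler_sum => i _; rewrite -real_normK ?num_real// ler_sqr ?nnegrE//.
  rewrite [leRHS]mx_normrE.
  exact: (le_bigmax _ (fun ij : 'I_1 * 'I_N => `|x ij.1 ij.2|) (0, i)).
by rewrite sumr_const card_ord mulr_natl.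
Qed.

Lemma compact_weight_bounded (K : set RN) : compact K ->
  exists2 M : R, 0 <= M & forall x, K x -> w (enorm x) <= M.
Proof.
(* Every number above [r] bounds the norm on [K]; [|r| + 1] is also nonnegative, as the monotonicity
   of [w] requires. *)
move=> /compact_bounded[r [_ /(_ (`|r| + 1))]].
rewrite (le_lt_trans (ler_norm r)) ?ltrDl// => /(_ isT) Kr.
have r0 : 0 <= Num.sqrt N%:R * (`|r| + 1) by rewrite mulr_ge0 ?sqrtr_ge0.
exists (w (Num.sqrt N%:R * (`|r| + 1))); first exact: (weight_ge0 (weightP w)).
move=> x /Kr xr; apply: (weight_nondecreasing (weightP w)).
- by rewrite in_itv/= andbT sqrtr_ge0.
- by rewrite in_itv/= andbT.
- by apply: le_trans (enorm_le x) _; rewrite ler_wpM2l ?sqrtr_ge0.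
Qed.

(** With [M] a bound of [w] on [K], the factor exp(-n w) is at least exp(-n M), so C = exp(n M)
    works for all derivatives at once. *)
Lemma p_weight_le_r (K : set RN) (n m : nat) : compact K ->
  exists2 C : R, 0 < C & forall a x, K x ->
    (p_weight w m.+1 a x <= C%:E * r_weight w m.+1 n a x)%E.
Proof.
move=> /compact_weight_bounded[M M0 KM].
exists (expR (n%:R * M)) => [|a x Kx]; first exact: expR_gt0.
rewrite /r_weight expeRD muleA -[leLHS]mul1e lee_wpmul2r ?expeR_ge0//.
by rewrite -EFinM lee_fin -expRD -[leLHS]expR0 ler_expR subr_ge0 ler_wpM2l// KM.
Qed.

(** Since [w] is nonnegative, exp(-n w) is at most 1, hence at most exp(w). *)
Lemma r_weight_le_q (n m : nat) a (x : RN) :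
  (r_weight w m n a x <= q_weight w m%:R 1 a x)%E.
Proof.
have w0 : 0 <= w (enorm x) by apply: (weight_ge0 (weightP w)); exact: sqrtr_ge0.
rewrite /r_weight expeRD /q_weight muleC lee_wpmul2l ?expeR_ge0//.
rewrite lee_fin ler_expR mul1r; apply: le_trans (w0).
by rewrite oppr_le0 mulr_ge0 ?ler0z.
Qed.

End inclusions.

(** * The inclusions and their continuity, first on the steps and then on the limits *)

Section spaces.
Context {R : realType} {N : nat} (w : weight R).

Lemma O_C_sub_O_M : {subset O_C N w <= O_M N w}.
Proof.
move=> f /asboolP[n /asboolP fn]; apply/asboolP => m; apply/asboolP.
(* The same [n] serves every [m]. *)
by exists n.
Qed.

Lemma O_C_step_sub_E (n : nat) : {subset O_C_step N w n <= E_omega N w}.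
Proof.
move=> f /asboolP fn; apply/asboolP; split; first by have /asboolP[] := fn 0%N.
move=> K m cK; have /asboolP[sf] := fn m.
case: (wsup_ltyP setT (r_weight w m.+1 n) f) => + _ => /[apply] -[M /= fM].
have [C C0 Cle] := p_weight_le_r w n m cK.
(* The value is chosen so that division by [C] leaves [|M| + 1], strictly above the bound [M]. *)
apply: lt_trans (ltry (C * (`|M| + 1))).
apply: (wsup_lt_dominated C0 Cle).
rewrite [C * _]mulrC mulfK ?gt_eqF//.
apply: (@le_lt_trans _ _ M%:E); last first.
  by rewrite lte_fin (le_lt_trans (ler_norm M))// ltrDl.
by apply/wsup_leP => a x _; exact: fM.
Qed.

Lemma O_C_sub_E : {subset O_C N w <= E_omega N w}.
Proof. by move=> f /asboolP[n /O_C_step_sub_E]. Qed.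

Lemma S_sub_O_C_step (n : nat) : {subset S_omega N w <= O_C_step N w n}.
Proof.
move=> f /asboolP[sf qf]; apply/asboolP => m; apply/asboolP; split=> //.
apply: le_lt_trans (qf m.+1%:R 1 _ _) => //.
apply/wsup_leP => a x _.
apply: (@le_trans _ _ (`|mderiv a f x|%:E * q_weight w m.+1%:R 1 a x)%E).
  by rewrite lee_wpmul2l ?lee_fin//; exact: r_weight_le_q.
by have /wsup_leP := lexx (q_ w m.+1%:R 1 f); exact.
Qed.

Lemma S_sub_O_C : {subset S_omega N w <= O_C N w}.
(* Indices are shifted by one: the witness 0 stands for the step 1. *)
Proof. by move=> f /(S_sub_O_C_step 1) fO; apply/asboolP; exists 0%N. Qed.

Lemma O_C_step_sub_O_omega (n : int) m :
  {subset O_C_step N w n <= O_omega N w m.+1 n}.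
Proof. by move=> f /asboolP. Qed.

Lemma p_seminorm (Km : {K : set 'rV[R]_N | compact K} * nat) :
  seminorm_on (E_omega N w) (p_ w (sval Km.1) Km.2.+1).
Proof.
apply: wsup_seminorm => [a x|f /asboolP[sf pf]]; first exact: p_weight_ge0.
by split=> //; apply: pf; exact: svalP.
Qed.

Lemma q_seminorm (mn : nat * nat) :
  seminorm_on (S_omega N w) (q_ w mn.1.+1%:R mn.2.+1%:R).
Proof.
apply: wsup_seminorm => [a x|f /asboolP[sf qf]]; first exact: q_weight_ge0.
by split=> //; apply: qf.
Qed.

Lemma r_seminorm (m : nat) (n : int) :
  seminorm_on (O_omega N w m n) (r_ w m n).
Proof.
by apply: wsup_seminorm => [a x|f /asboolP//]; exact: r_weight_ge0.
Qed.

Lemma r_step_seminorm (n : int) (m : nat) :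
  seminorm_on (O_C_step N w n) (r_ w m.+1 n).
Proof.
apply: wsup_seminorm => [a x|f /asboolP/(_ m)/asboolP//].
exact: r_weight_ge0.
Qed.

Lemma O_C_step_O_omega_continuous (n : int) m :
  continuous (inclusion_map (@O_C_step_sub_O_omega n m) :
    O_C_step_space N w n -> O_omega_space N w m.+1 n).
Proof.
apply: seminorm_continuous => [i|i|_ e e0].
- exact: r_step_seminorm.
- exact: r_seminorm.
- by exists m, e.
Qed.

Lemma S_O_C_step_continuous (n : nat) :
  continuous (inclusion_map (@S_sub_O_C_step n) :
    S_omega_space N w -> O_C_step_space N w n).
Proof.
apply: seminorm_continuous => [i|i|m e e0].
- exact: q_seminorm.
- exact: r_step_seminorm.
(* After the index shift this is the norm q with parameters m + 1 and 1, and the comparison constant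
   is 1. *)
- exists (m, 0%N), e => // f; rewrite -{1}(divr1 e).
  apply: wsup_lt_dominated => // a x _; rewrite mul1e.
  exact: r_weight_le_q.
Qed.

Lemma O_C_step_E_continuous (n : nat) :
  continuous (inclusion_map (@O_C_step_sub_E n) :
    O_C_step_space N w n -> E_omega_space N w).
Proof.
apply: seminorm_continuous => [i|i|[[K cK] m] e e0].
- exact: r_step_seminorm.
- exact: p_seminorm.
- have [C C0 Cle] := p_weight_le_r w n m cK.
  exists m, (e / C); first by rewrite divr_gt0.
  by move=> f; exact: wsup_lt_dominated.
Qed.

(** Projecting to a fixed [m] leaves a map between two inductive limits, which on the step n + 1
    factors through the space with norm [r_ w m.+1 n.+1]. *)
Lemma O_C_O_M_continuous :
  continuous (inclusion_map O_C_sub_O_M : O_C_space N w -> O_M_space N w).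
Proof.
apply: proj_space_continuous => m.
have h : {subset O_C N w <= O_M_step N w m.+1}.
  by move=> f /O_C_sub_O_M; exact: O_M_sub_step.
(* Inclusions keep the underlying function, so composites agree whatever the membership proofs. *)
rewrite (_ : _ \o _ = inclusion_map h); last first.
  by apply/funext => f; exact: val_inj.
apply: lc_final_map_continuous => n.
rewrite (_ : _ \o _ = inclusion_map (@O_omega_sub_step R N w m.+1 n) \o
  inclusion_map (@O_C_step_sub_O_omega n.+1 m)); last first.
  by apply/funext => f; exact: val_inj.
move=> f; apply: (@continuous_comp _ (O_omega_space N w m.+1 n.+1)).
  exact: O_C_step_O_omega_continuous.
exact: (@lc_final_inj_continuous R[i] _ _
  (fun n => O_omega_space N w m.+1 n.+1)
  (fun n => inclusion_map (@O_omega_sub_step R N w m.+1 n))).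
Qed.

Lemma S_O_C_continuous :
  continuous (inclusion_map S_sub_O_C : S_omega_space N w -> O_C_space N w).
Proof.
rewrite (_ : inclusion_map _ = inclusion_map (@O_C_step_sub R N w 0) \o
  inclusion_map (@S_sub_O_C_step 1)); last first.
  by apply/funext => f; exact: val_inj.
move=> f; apply: (@continuous_comp _ (O_C_step_space N w 1)).
  exact: S_O_C_step_continuous.
exact: (@lc_final_inj_continuous R[i] _ _
  (fun n => O_C_step_space N w n.+1)
  (fun n => inclusion_map (@O_C_step_sub R N w n))).
Qed.

(** The target is locally convex as a seminorm space, so continuity on each step suffices. *)
Lemma O_C_E_continuous :
  continuous (inclusion_map O_C_sub_E : O_C_space N w -> E_omega_space N w).
Proof.
apply: (lc_final_continuous (tau := Topological.class (E_omega_space N w))).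
  by apply: seminorm_space_lc => i; exact: p_seminorm.
move=> n; rewrite (_ : _ \o _ = inclusion_map (@O_C_step_sub_E n.+1)).
  exact: O_C_step_E_continuous.
by apply/funext => f; exact: val_inj.
Qed.

End spaces.

Theorem theorem3p8 (R : realType) (N : nat) (hN : (0 < N)%N) (w : weight R) :
  (exists h : {subset O_C N w <= O_M N w},
     continuous (inclusion_map h : O_C_space N w -> O_M_space N w)) /\
  ((exists h : {subset S_omega N w <= O_C N w},
      continuous (inclusion_map h : S_omega_space N w -> O_C_space N w)) /\
   (exists h : {subset O_C N w <= E_omega N w},
      continuous (inclusion_map h : O_C_space N w -> E_omega_space N w))).
Proof.
split; first by exists (@O_C_sub_O_M R N w); exact: O_C_O_M_continuous.
split; first by exists (@S_sub_O_C R N w); exact: S_O_C_continuous.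
by exists (@O_C_sub_E R N w); exact: O_C_E_continuous.
Qed.
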